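(* Let $(\mathcal X,\mathscr X)$ be a measurable space, let $(\mathcal Y,\mathscr Y,\nu)$ be a finite measure space with $\nu$ normalized according to $\nu(\mathcal Y)=1$, and let $\rho\colon\mathcal X\times\mathcal Y\to[0,\infty]$ be a distortion function. Let $k\in(0,\infty)$, suppose that $\nu$ is $\rho^{1/k}$-superregular of dimension $m\in(0,\infty)$ with superregularity constants $b\in(0,\infty)$ and $\delta_0\in(0,\infty]$, set $$\beta:=\operatorname*{ess\,sup}_{y\in\mathcal Y}\ \sup_{x\in\mathcal X}\rho^{1/k}(x,y),$$ and assume that $\beta<\infty$ if $\delta_0<\infty$. Then every random variable $X$ taking values in $(\mathcal X,\mathscr X)$ satisfies $V_n(X)\le U_n$ for all $n\in\mathbb N$, where $$U_n=\Gamma\left(1+\frac km\right)(bn)^{-\frac km}\quad\text{if }\beta\le\delta_0$$ and $$U_n=\Gamma\left(1+\frac km\right)(bn)^{-\frac km}+(\beta^k-\delta_0^k)\,e^{-bn\delta_0^m}\quad\text{if }\beta>\delta_0.$$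
   Context: All measures are positive, and $\sigma$-algebras contain all singletons. A distortion function $\rho\colon\mathcal X\times\mathcal Y\to[0,\infty]$ is a function measurable with respect to the product $\sigma$-algebra. For a distortion function $\varrho$ on $\mathcal X\times\mathcal Y$, a measure $\nu$ on $(\mathcal Y,\mathscr Y)$ is $\varrho$-superregular of dimension $m\in[0,\infty)$ with superregularity constants $b\in(0,\infty)$ and $\delta_0\in(0,\infty]$ if $$\nu(\{y\in\mathcal Y:\varrho(x,y)<\delta\})\ge b\,\delta^m\quad\text{for all }x\in\mathcal X\text{ and }\delta\in(0,\delta_0).$$ The essential supremum over $y\in\mathcal Y$ is with respect to $\nu$, i.e. the infimum of all $a\in[0,\infty]$ such that $\sup_{x\in\mathcal X}\rho^{1/k}(x,y)\le a$ for $\nu$-almost all $y$. $n$-th quantization error: $V_n(X)=\inf_{f}\mathbb E[\rho(X,f(X))]$ over all measurable $f\colon\mathcal X\to\mathcal Y$ with $|f(\mathcal X)|\le n$. *)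

(* Defs.v *)
From HB Require Import structures.
From mathcomp Require Import all_boot all_order all_algebra.
From mathcomp Require Import all_classical all_reals all_analysis.
From mathcomp Require Import measurable_realfun ess_sup_inf.

Set Implicit Arguments.
Unset Strict Implicit.
Unset Printing Implicit Defensive.

Import Order.TTheory GRing.Theory Num.Theory.
Import numFieldNormedType.Exports.

Local Open Scope classical_set_scope.
Local Open Scope ring_scope.
Local Open Scope ereal_scope.

(* Euler's integral.  It converges for 0 < s; otherwise Rintegral returns the
   junk value 0. *)
Definition Gamma (R : realType) (s : R) : R :=
  (\int[lebesgue_measure]_(t in `]0, +oo[) (t `^ (s - 1) * expR (- t)))%R.

Definition distortion dX dY (X : measurableType dX) (Y : measurableType dY)
    (R : realType) (rho : X * Y -> \bar R) : Prop :=
  measurable_fun [set: X * Y] rho /\ forall z, 0 <= rho z.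

Definition superregular dX dY (X : measurableType dX) (Y : measurableType dY)
    (R : realType) (rho : X * Y -> \bar R) (nu : {measure set Y -> \bar R})
    (m b : R) (delta0 : \bar R) : Prop :=
  [/\ (0 <= m)%R, (0 < b)%R, 0 < delta0 &
    forall (x : X) (delta : R), (0 < delta)%R -> delta%:E < delta0 ->
      (b * delta `^ m)%:E <= nu [set y | rho (x, y) < delta%:E]].

Definition quantization_error dO dX dY (Omega : measurableType dO)
    (X : measurableType dX) (Y : measurableType dY) (R : realType)
    (P : probability Omega R) (rho : X * Y -> \bar R) (n : nat)
    (xi : Omega -> X) : \bar R :=
  ereal_inf [set \int[P]_w rho (xi w, f (xi w)) | f in
    [set f : X -> Y | measurable_fun [set: X] f /\ (range f #<= `I_n)%card]].

Definition ess_sup_root dX dY (X : measurableType dX) (Y : measurableType dY)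
    (R : realType) (rho : X * Y -> \bar R) (nu : {measure set Y -> \bar R})
    (k : R) : \bar R :=
  ess_sup nu (fun y => ereal_sup (range (fun x => rho (x, y) `^ k^-1))).

(* The second branch is only reached when delta0 < beta; with delta0 < +oo ->
   beta < +oo, all terms there are finite. *)
Definition quantization_bound (R : realType) (k m b : R)
    (delta0 beta : \bar R) (n : nat) : \bar R :=
  let main := (Gamma (1 + k / m) * (b * n%:R) `^ (- (k / m)))%:E in
  if beta <= delta0 then main
  else main + (beta `^ k - delta0 `^ k) *
              expeR (- ((b * n%:R)%:E * delta0 `^ m)).

(* Main.v *)
Require Import Defs.
From HB Require Import structures.
From mathcomp Require Import all_boot all_order all_algebra.
From mathcomp Require Import all_classical all_reals all_analysis.
From mathcomp Require Import measurable_realfun ess_sup_inf.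
From mathcomp Require Import ring lra.

Set Implicit Arguments.
Unset Strict Implicit.
Unset Printing Implicit Defensive.

Import Order.TTheory GRing.Theory Num.Theory.
Import numFieldNormedType.Exports.

Local Open Scope classical_set_scope.
Local Open Scope ring_scope.
Local Open Scope ereal_scope.

(** The bound comes from a random codebook.  Draw y_1, ..., y_n independently
from [nu] and quantize a source value x by its nearest codeword, so that the
distortion exceeds t exactly when all n codewords miss, an event of probability
[nu {y | t < rho (x, y)} ^+ n].  By the layer-cake formula the expected
distortion at x is therefore
   int_0^oo nu {y | t < rho (x, y)} ^ n dt,
and some codebook does at least as well as the average one.

For t = s^k with s <= delta0, superregularity gives
[nu {y | t < rho (x, y)} <= 1 - b * s `^ m <= expR (- (b * s `^ m))]; for larger
t the value at s = delta0 still bounds the probability, which vanishes once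
t >= beta^k ([superregular_tail], [ess_sup_root_tail]).  Integrating,
the range t <= delta0^k contributes at most
   int_0^oo exp (- b n t^(m/k)) dt = Gamma (1 + k/m) (b n)^(-k/m)
([integral_stretched_exponential]), and the range from delta0^k to beta^k, when
there is one, contributes (beta^k - delta0^k) exp (- b n delta0^m)
([integral_tail_le]).

The averaging over codebooks is done one codeword at a time, by the method of
conditional expectations ([random_coding]).  With Z the product of the sample
space and the time axis, and a (z, y) the indicator that the codeword y misses
at z, the double integral of the product of the a (z, y_i) is the quantity to be
made small; each y_i can be chosen so that it is at most its mean over y_i.
Only Tonelli's theorem for pairs is needed, never the n-fold product of [nu].

Since b * delta ^ m is bounded by the total mass 1 for all delta < delta0, the
radius delta0 is finite as soon as there is a source value, and hence so is beta
([superregular_lty]). *)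

(** * The stretched exponential integral *)

Lemma integral_expR_tail (R : realType) (a c : R) : (0 < c)%R ->
  \int[lebesgue_measure]_(u in `]a, +oo[) (expR (- c * u))%:E =
  (expR (- c * a) / c)%:E.
Proof.
move=> c0.
have cexp : continuous (fun z : R => expR (- c * z) : R).
  move=> z; apply: continuous_comp; last exact: continuous_expR.
  by apply: cvgM; [exact: cvg_cst|exact: cvg_id].
rewrite integral_itv_obnd_cbnd; last first.
  apply: measurable_funTS; apply/measurable_EFinP.
  exact: continuous_measurable_fun.
have cF : continuous (fun z : R => - (expR (- c * z) / c) : R)%R.
  by move=> z; apply: cvgN; apply: cvgM; [exact: cexp|exact: cvg_cst].
have dF (z : R) : is_derive z 1%R (fun z : R => - (expR (- c * z) / c) : R)%R
    (expR (- c * z)).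
  apply: is_derive_eq.
  have cN0 : (c != 0)%R by rewrite gt_eqF.
  rewrite /GRing.scale/=.
  by field.
rewrite (@ge0_continuous_FTC2y _ (fun z => expR (- c * z))%R
  (fun x => - (expR (- c * x) / c))%R a 0%R)//.
- by rewrite sub0e EFinN oppeK.
- exact: continuous_subspaceT.
- rewrite -[X in _ --> X]oppr0; apply: cvgN.
  rewrite -[X in _ --> X](mul0r c^-1)%R; apply: cvgMl.
  under eq_fun do rewrite mulNr.
  apply: (cvg_comp _ _ _ (@cvgr_expR R)).
  apply: gt0_cvgMry => //.
- by apply: cvg_at_right_filter; exact: cF.
- by move=> z _; rewrite derive1E; apply: derive_val.
Qed.

(** [Gamma] is the finite part of an integral, so the content here is
convergence: u^q is at most a constant times exp (u/2). *)
Lemma GammaE (R : realType) (q : R) : (0 < q)%R ->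
  \int[lebesgue_measure]_(u in `]0%R, +oo[) (u `^ q * expR (- u))%:E =
  (Gamma (1 + q))%:E.
Proof.
move=> q0; rewrite /Gamma /Rintegral.
under [in RHS]eq_integral do rewrite addrAC subrr add0r.
rewrite fineK// ge0_fin_numE; last first.
  by apply: integral_ge0 => u _; rewrite lee_fin mulr_ge0 ?powR_ge0 ?expR_ge0.
have mexp (a : R) : measurable_fun [set: R] (fun u => expR (a * u)).
  apply: measurableT_comp; first exact: measurable_expR.
  exact: mulrl_measurable.
apply: (@le_lt_trans _ _ (\int[lebesgue_measure]_(u in `]0%R, +oo[)
    (((2 * q) `^ q)%:E * (expR (- 2^-1 * u))%:E))).
  apply: ge0_le_integral => //=.
  - by move=> u _; rewrite lee_fin mulr_ge0 ?powR_ge0 ?expR_ge0.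
  - apply: measurable_funTS; apply/measurable_EFinP.
    apply: measurable_funM; first exact: measurable_powR.
    by apply: eq_measurable_fun (mexp (-1)%R) => u _; rewrite mulN1r.
  - apply: measurable_funTS; apply: measurable_funeM; apply/measurable_EFinP.
    exact: mexp.
  - move=> u; rewrite in_itv/= andbT => u0; rewrite lee_fin.
    have q20 : (0 < 2 * q)%R by rewrite mulr_gt0.
    (* the q-th power of [x <= expR x] at [x = u / (2 * q)] *)
    have : ((u / (2 * q)) `^ q <= expR (u / (2 * q)) `^ q)%R.
      rewrite ge0_ler_powR ?nnegrE ?expR_ge0 ?divr_ge0 ?(ltW q0) ?(ltW u0) ?(ltW q20)//.
      by apply: le_trans (expR_ge1Dx _); rewrite lerDr.
    rewrite -expRM (_ : u / (2 * q) * q = u / 2)%R; last first.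
      have qN0 : (q != 0)%R by rewrite gt_eqF.
      by field.
    rewrite powRM ?invr_ge0 ?(ltW u0) ?(ltW q20)// -powR_inv1 ?(ltW q20)// -powRrM.
    rewrite mulN1r powRN ler_pdivrMr ?powR_gt0// => le_uq.
    rewrite (_ : - 2^-1 * u = u / 2 - u)%R; last by lra.
    by rewrite expRD mulrA ler_wpM2r ?expR_ge0// mulrC.
rewrite ge0_integralZl//=.
- rewrite (@integral_expR_tail R 0 2^-1)//.
  rewrite -EFinM. exact: ltry.
- by apply: measurable_funTS; apply/measurable_EFinP; exact: mexp.
- by rewrite lee_fin powR_ge0.
Qed.

(** Writing exp (- c t^p) as the integral of exp (-u) over u > c t^p and
exchanging the integrals turns the inner one into the length (u/c)^(1/p) of
{t > 0 | c t^p < u}.  This replaces the substitution u = c t^p, followed by the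
functional equation of Gamma. *)
Lemma integral_stretched_exponential (R : realType) (c p : R) :
  (0 < c)%R -> (0 < p)%R ->
  \int[lebesgue_measure]_(t in `]0%R, +oo[) (expR (- (c * t `^ p)))%:E =
  (Gamma (1 + p^-1) * c `^ (- p^-1))%:E.
Proof.
move=> c0 p0.
have pV0 : (0 < p^-1)%R by rewrite invr_gt0.
(* the region under the graph, where the integrand will be exp (-u) *)
pose E := [set z : R * R | 0 < z.1 /\ c * z.1 `^ p < z.2]%R.
pose f : R * R -> \bar R := (fun z => (expR (- z.2))%:E) \_ E.
have mE : measurable E.
  rewrite (_ : E = [set z | (0%:E < z.1%:E)%E] `&`
      [set z | ((c * z.1 `^ p)%:E < z.2%:E)%E]).
    apply: measurableI; rewrite -[X in measurable X]setTI; apply: measurable_lte => //.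
    - by apply/measurable_EFinP; exact: measurable_fst.
    - apply/measurable_EFinP; apply: measurable_funM => //.
      exact: (measurableT_comp (measurable_powR p) measurable_fst).
    - by apply/measurable_EFinP; exact: measurable_snd.
  by apply/seteqP; split => z /=; rewrite !lte_fin.
have mf : measurable_fun setT f.
  apply/(measurable_restrictT _ mE); apply: measurable_funTS.
  apply/measurable_EFinP; apply: measurableT_comp; first exact: measurable_expR.
  by apply: measurableT_comp => //; exact: measurable_snd.
have f0 z : 0 <= f z.
  by rewrite /f patchE; case: ifP => // _; rewrite lee_fin expR_ge0.
have := @fubini_tonelli _ _ _ _ R (@lebesgue_measure R) (@lebesgue_measure R) f mf f0.
have -> : \int[lebesgue_measure]_x \int[lebesgue_measure]_y f (x, y) =
    \int[lebesgue_measure]_(t in `]0%R, +oo[) (expR (- (c * t `^ p)))%:E.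
  rewrite [RHS]integral_mkcond; apply: eq_integral => t _.
  rewrite patchE mem_setE in_itv/= andbT; case: ltP => t0.
    rewrite -[(c * _)%R]mul1r -mulNr -[expR _]divr1 -integral_expR_tail//.
    rewrite [RHS]integral_mkcond; apply: eq_integral => u _.
    rewrite /f !patchE mem_setE in_itv/= andbT mulN1r; congr (if _ then _ else _).
    by apply/idP/idP; rewrite inE /E/= ?mul1r; [case|].
  apply: integral0_eq => u _; rewrite /f patchE memNset// /E/= => -[].
  by rewrite ltNge t0.
move=> ->.
have -> : \int[lebesgue_measure]_y \int[lebesgue_measure]_x f (x, y) =
    \int[lebesgue_measure]_(u in `]0%R, +oo[)
      ((c `^ (- p^-1))%:E * (u `^ p^-1 * expR (- u))%:E).
  rewrite [RHS]integral_mkcond; apply: eq_integral => u _.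
  rewrite patchE mem_setE in_itv/= andbT; case: ltP => u0.
    transitivity (\int[lebesgue_measure]_(t in `]0%R, ((u / c) `^ p^-1)%R[)
        (expR (- u))%:E).
      rewrite [RHS]integral_mkcond; apply: eq_integral => t _.
      rewrite /f !patchE mem_setE in_itv/=; congr (if _ then _ else _).
      have tE : (0 < t -> (t < (u / c) `^ p^-1) = (c * t `^ p < u))%R.
        move=> t0; rewrite [(c * _)%R]mulrC -ltr_pdivlMr//; apply/idP/idP => h.
          have := @gt0_ltr_powR _ p p0 t ((u / c) `^ p^-1)%R.
          rewrite -powRrM mulVf ?gt_eqF// powRr1 ?divr_ge0 ?ltW//; apply => //.
          - by rewrite nnegrE ltW.
          - by rewrite nnegrE powR_ge0.
        have := @gt0_ltr_powR _ p^-1 pV0 (t `^ p)%R (u / c)%R.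
        rewrite -powRrM mulfV ?gt_eqF// powRr1 ?(ltW t0)//; apply => //.
        - by rewrite nnegrE powR_ge0.
        - by rewrite nnegrE divr_ge0// ltW.
      apply/idP/idP; rewrite inE /E/=.
        by case=> t0; rewrite t0 tE.
      by move=> /andP[t0]; rewrite tE.
    rewrite integral_cst//= lebesgue_measure_itv/= lte_fin.
    rewrite powR_gt0 ?divr_gt0// sube0 -!EFinM; congr EFin.
    rewrite powRM ?invr_ge0 ?ltW// -(powR_inv1 (ltW c0)) -powRrM mulN1r.
    by rewrite mulrC mulrAC mulrC.
  apply: integral0_eq => t _; rewrite /f patchE memNset// /E/= => -[_].
  by apply/negP; rewrite -leNgt (le_trans u0)// mulr_ge0 ?powR_ge0 ?ltW.
rewrite ge0_integralZl//=.
- by rewrite GammaE// -EFinM mulrC.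
- apply: measurable_funTS; apply/measurable_EFinP.
  apply: measurable_funM; first exact: measurable_powR.
  by apply: measurableT_comp => //; exact: measurable_expR.
- by move=> u _; rewrite lee_fin mulr_ge0 ?powR_ge0 ?expR_ge0.
- by rewrite lee_fin powR_ge0.
Qed.

(** * Layer-cake formula and averaging *)

(** The layer-cake formula, for a single value: the length of ]0, g[ is g. *)
Lemma integral_indic_ltEFin (R : realType) (g : \bar R) : 0 <= g ->
  \int[lebesgue_measure]_(t in `]0%R, +oo[) (\1_[set t : R | (t%:E < g)%E] t)%:E = g.
Proof.
move=> g0.
have mg : measurable [set t : R | (t%:E < g)%E].
  by rewrite -[X in measurable X]setTI; exact: measurable_lte.
transitivity (@lebesgue_measure R [set t | 0 < t%:E < g]).
  rewrite (_ : [set t : R | 0 < t%:E < g] =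
     [set` `]0%R, +oo[] `&` [set t : R | (t%:E < g)%E]); last first.
    by apply/seteqP; split => t /=; rewrite in_itv/= andbT lte_fin => /andP.
  by rewrite integral_indic// setIC.
case: g g0 {mg} => [r| |//] g0.
- rewrite (_ : [set t | _] = [set` `]0%R, r[]); last first.
    by apply/seteqP; split => t /=; rewrite in_itv/= !lte_fin.
  rewrite lebesgue_measure_itv/= lte_fin; case: ltP => [_|r0].
    by rewrite sube0.
  by congr EFin; apply/eqP; rewrite eq_le r0 -lee_fin g0.
- rewrite (_ : [set t | _] = [set` `]0%R, +oo[]); last first.
    by apply/seteqP; split => t /=; rewrite in_itv/= lte_fin ltry.
  by rewrite lebesgue_measure_itv/= ltry.
Qed.

(** The averaging principle: were f everywhere above its mean I, then f - I
would be positive with integral 0. *)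
Lemma exists_le_integral d (Y : measurableType d) (R : realType)
    (nu : {measure set Y -> \bar R}) (f : Y -> \bar R) :
  nu [set: Y] = 1 -> measurable_fun [set: Y] f -> (forall y, 0 <= f y) ->
  exists y, f y <= \int[nu]_y f y.
Proof.
move=> nu1 mf f0; apply: contrapT => /forallNP f_gt.
have [I IE] : exists I, I = \int[nu]_y f y by eexists.
have {}f_gt y : I < f y by rewrite IE ltNge; exact/negP.
have [y0 _] : [set: Y] !=set0.
  apply/set0P/eqP => Y0; move: nu1; rewrite Y0 measure0 => /esym/eqP.
  by rewrite onee_eq0.
have I0 : 0 <= I by rewrite IE; exact: integral_ge0.
have Ifin : I \is a fin_num.
  by rewrite ge0_fin_numE// (lt_le_trans (f_gt y0))// leey.
have mg : measurable_fun [set: Y] (fun y => f y - I).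
  by apply: emeasurable_funB => //; exact: measurable_cst.
have g0 y : 0 < f y - I by rewrite sube_gt0.
(* the mean of the positive function f - I is I - I *)
have int0 : \int[nu]_y `|f y - I| = 0.
  have : \int[nu]_y (f y - I + I) = I.
    by rewrite [RHS]IE; apply: eq_integral => y _; rewrite subeK.
  rewrite ge0_integralD//; last by move=> y _; exact: ltW.
  rewrite integral_cst// nu1 mule1 => h.
  under eq_integral do rewrite gee0_abs ?ltW//.
  by have := congr1 (fun z => z - I) h; rewrite addeK// subee.
have [B [mB B0 /(_ _ _)/= subB]] := (ae_eq_integral_abs nu measurableT mg).1 int0.
have BT : B = [set: Y].
  apply/seteqP; split => // y _; apply: subB => /(_ Logic.I) h.
  by move: (g0 y); rewrite h ltxx.
by move: B0; rewrite BT nu1 => /eqP; rewrite onee_eq0.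
Qed.

Lemma lee_expe (R : realType) (x y : \bar R) n :
  0 <= x -> x <= y -> x ^+ n <= y ^+ n.
Proof.
move=> x0 xy; elim: n => [|n IHn]; first by rewrite !expe0.
by rewrite !expeS lee_pmul// expe_ge0.
Qed.

Lemma emeasurable_funX d (T : measurableType d) (R : realType)
    (f : T -> \bar R) n :
  measurable_fun [set: T] f -> measurable_fun [set: T] (fun x => f x ^+ n).
Proof.
move=> mf; elim: n => [|n IHn]; first exact: measurable_cst.
by under eq_fun do rewrite expeS; exact: emeasurable_funM.
Qed.

Lemma emeasurable_prod d (T : measurableType d) (R : realType) (I : Type)
    (s : seq I) (f : I -> T -> \bar R) :
  (forall i, measurable_fun [set: T] (f i)) ->
  measurable_fun [set: T] (fun x => \big[mule/1]_(i <- s) f i x).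
Proof.
move=> mf; elim: s => [|i s IHs].
  by under eq_fun do rewrite big_nil; exact: measurable_cst.
by under eq_fun do rewrite big_cons; exact: emeasurable_funM.
Qed.

(** * Random codebooks *)

(** Derandomization of n independent draws from [nu], one at a time.  The weight
h is what makes the induction go through: once the first codeword y is fixed,
its factor a (z, y) is absorbed into h.  The choice of y is
[exists_le_integral] applied to the integral over z in which the other n
factors are still averaged. *)
Lemma random_coding dZ dY (Z : measurableType dZ) (Y : measurableType dY)
    (R : realType) (mu : {sigma_finite_measure set Z -> \bar R})
    (nu : {sigma_finite_measure set Y -> \bar R}) (a : Z * Y -> \bar R) :
  nu [set: Y] = 1 -> measurable_fun [set: Z * Y] a -> (forall u, 0 <= a u) ->
  forall n (h : Z -> \bar R), measurable_fun [set: Z] h ->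
    (forall z, 0 <= h z) ->
  exists s : seq Y, size s = n /\
    \int[mu]_z (h z * \big[mule/1]_(y <- s) a (z, y)) <=
    \int[mu]_z (h z * (\int[nu]_y a (z, y)) ^+ n).
Proof.
move=> nu1 ma a0 n; have mA := @measurable_fun_fubini_tonelli_F _ _ _ _ _ nu a ma a0.
have A0 z : 0 <= fubini_F nu a z by apply: integral_ge0.
elim: n => [|n IHn] h mh h0.
  by exists [::]; split=> //; under eq_integral do rewrite big_nil.
pose g (u : Z * Y) := h u.1 * fubini_F nu a u.1 ^+ n * a u.
have mg : measurable_fun [set: Z * Y] g.
  apply: emeasurable_funM => //; apply: emeasurable_funM.
    exact: (measurableT_comp mh measurable_fst).
  exact: (measurableT_comp (emeasurable_funX n mA) measurable_fst).
have g0 u : 0 <= g u by rewrite /g !mule_ge0// expe_ge0.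
have [y le_y] := exists_le_integral nu1
  (@measurable_fun_fubini_tonelli_G _ _ _ _ _ mu g mg g0)
  (fun y => integral_ge0 _ (fun z _ => g0 (z, y))).
have [|z|s [sizes le_s]] := IHn (fun z => h z * a (z, y)).
- apply: emeasurable_funM => //; exact: measurable_fun_pair1.
- by rewrite mule_ge0.
exists (y :: s); split; first by rewrite /= sizes.
under eq_integral do rewrite big_cons muleA.
apply: (le_trans le_s); rewrite [leLHS](_ : _ = fubini_G mu g y); last first.
  by apply: eq_integral => z _; rewrite /g/= -!muleA; congr (_ * _); rewrite muleC.
apply: (le_trans le_y).
rewrite /fubini_G -fubini_tonelli// le_eqVlt; apply/orP; left; apply/eqP.
apply: eq_integral => z _.
transitivity (\int[nu]_y (h z * fubini_F nu a z ^+ n * a (z, y))) => //.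
rewrite ge0_integralZl//; first 1 last.
- exact: measurable_fun_pair2.
- by rewrite mule_ge0// expe_ge0.
by rewrite expeS -muleA; congr (_ * _); rewrite muleC.
Qed.

(** Adding a codeword y keeps the previous quantizer except where y does at
least as well; each step only switches between two measurable maps on a
measurable set. *)
Lemma nearest_codeword dX dY (X : measurableType dX) (Y : measurableType dY)
    (R : realType) (rho : X * Y -> \bar R) (s : seq Y) :
  measurable_fun [set: X * Y] rho -> s != [::] ->
  exists f : X -> Y, [/\ measurable_fun [set: X] f, forall x, f x \in s &
    forall x y, y \in s -> rho (x, f x) <= rho (x, y)].
Proof.
move=> mrho; elim: s => // y [_ _|y' s /(_ isT)[f [mf fs f_min]] _].
  exists (fun=> y); split=> [|x|x y']; first exact: measurable_cst.
    by rewrite mem_head.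
  by rewrite inE => /eqP ->.
exists (fun x => if rho (x, y) <= rho (x, f x) then y else f x); split.
- apply: measurable_fun_ifT => //; apply: measurable_fun_lee.
    exact: measurable_fun_pair1.
  by apply: measurableT_comp => //; apply: measurable_fun_pair.
- by move=> x; case: ifP => _; rewrite in_cons ?eqxx// fs orbT.
- move=> x z; rewrite in_cons => /predU1P[->|zs].
    by case: (leP (rho (x, y)) (rho (x, f x))) => // /ltW.
  case: (leP (rho (x, y)) (rho (x, f x))) => [/le_trans|_]; last exact: f_min.
  by apply; exact: f_min.
Qed.

Lemma card_range_seq (X : Type) (Y : choiceType) (f : X -> Y) (s : seq Y) :
  (forall x, f x \in s) -> (range f #<= `I_(size s))%card.
Proof.
move=> fs; case: s fs => [|y0 s] fs.
  rewrite (_ : range f = set0) ?card_ge0//.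
  by apply/seteqP; split=> // y [x _ _]; have := fs x.
apply: card_le_trans (card_image_le (nth y0 (y0 :: s)) `I_(size (y0 :: s))).
apply: subset_card_le => _ [x _ <-].
by exists (index (f x) (y0 :: s)); [rewrite /mkset index_mem|exact: nth_index].
Qed.

(** A constant of its own, so that structure inference on it finds the
sigma-finite measure below and not the product of two subprobabilities. *)
Definition probability_product d1 d2 (T1 : measurableType d1)
    (T2 : measurableType d2) (R : realType) (P : probability T1 R)
    (m2 : {sigma_finite_measure set T2 -> \bar R}) := P \x m2.

Section probability_product.
Context d1 d2 (T1 : measurableType d1) (T2 : measurableType d2) (R : realType).
Context (P : probability T1 R) (m2 : {sigma_finite_measure set T2 -> \bar R}).

HB.instance Definition _ := Measure.on (probability_product P m2).

Lemma probability_product_sigma_finite :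
  sigma_finite [set: T1 * T2] (probability_product P m2).
Proof.
have [G GT Gfin] := sigma_finiteT m2.
exists (fun i => [set: T1] `*` G i); first by rewrite -setX_bigcupr -GT setXTT.
move=> i; have [mG Goo] := Gfin i; split; first exact: measurableX.
by rewrite [ltLHS]product_measure1E// [X in X * _](@probability_setT _ _ _ P) mul1e.
Qed.

HB.instance Definition _ := Measure_isSigmaFinite.Build _ _ _
  (probability_product P m2) probability_product_sigma_finite.

End probability_product.

(** The random coding bound.  The nearest-codeword map for the codebook s of
[random_coding] has distortion above t only if every codeword of s misses by
more than t, so its expected distortion, a layer-cake integral, is at most the
integral that [random_coding] controls. *)
Lemma quantization_error_le_tail dO dX dY (Omega : measurableType dO)
    (X : measurableType dX) (Y : measurableType dY) (R : realType)
    (P : probability Omega R) (rho : X * Y -> \bar R) (xi : {RV P >-> X})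
    (nu : {sigma_finite_measure set Y -> \bar R}) (n : nat) (V : \bar R) :
  nu [set: Y] = 1 -> distortion rho -> (0 < n)%N ->
  (forall x, \int[lebesgue_measure]_(t in `]0%R, +oo[)
    nu [set y | t%:E < rho (x, y)] ^+ n <= V) ->
  quantization_error P rho n xi <= V.
Proof.
move=> nu1 [mrho rho0] n0 tail_le.
pose T : set (Omega * measurableTypeR R * Y) :=
  [set u | u.1.2%:E < rho (xi u.1.1, u.2)].
have mxi : measurable_fun [set: Omega] xi by exact: measurable_funP.
have mt : measurable_fun [set: Omega * measurableTypeR R] (fun z => z.2%:E).
  by apply/measurable_EFinP; exact: measurable_snd.
have mT : measurable T.
  rewrite -[X in measurable X]setTI; apply: measurable_lte => //.
    exact: (measurableT_comp mt measurable_fst).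
  apply: (measurableT_comp mrho); apply: measurable_fun_pair.
    apply: (measurableT_comp mxi).
    exact: (measurableT_comp measurable_fst measurable_fst).
  exact: measurable_snd.
pose a (u : Omega * measurableTypeR R * Y) : \bar R := (\1_T u)%:E.
have ma : measurable_fun [set: Omega * measurableTypeR R * Y] a.
  by apply/measurable_EFinP; exact: measurable_indic.
have a0 u : 0 <= a u by rewrite lee_fin.
pose D : set (Omega * measurableTypeR R) := [set: Omega] `*` `]0%R, +oo[.
have mD : measurable D by exact: measurableX.
(* h restricts the time axis to positive times *)
pose h (z : Omega * measurableTypeR R) : \bar R := (\1_D z)%:E.
have mh : measurable_fun [set: Omega * measurableTypeR R] h.
  by apply/measurable_EFinP; exact: measurable_indic.
have h0 z : 0 <= h z by rewrite lee_fin.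
have [s [sizes le_s]] := @random_coding _ _ _ _ R
  (probability_product P (@lebesgue_measure R))
  nu a nu1 ma a0 n h mh h0.
have sN0 : s != [::] by rewrite -size_eq0 sizes -lt0n.
have [f [mf fs f_min]] := nearest_codeword mrho sN0.
pose rf w := rho (xi w, f (xi w)).
have mrf : measurable_fun [set: Omega] rf.
  apply: (measurableT_comp mrho); apply: measurable_fun_pair => //.
  exact: measurableT_comp mf mxi.
apply: (@le_trans _ _ (\int[P]_w rf w)).
  apply: ereal_inf_lbound; exists f => //; split=> //.
  by rewrite -sizes; exact: card_range_seq.
have hE (w : Omega) (g : R -> \bar R) :
    \int[lebesgue_measure]_t (h (w, t) * g t) =
    \int[lebesgue_measure]_(t in `]0%R, +oo[) g t.
  rewrite [RHS]integral_mkcond epatch_indic; apply: eq_integral => t _.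
  rewrite /h muleC /=; congr (_ * _%:E).
  rewrite !indicE; congr (_%:R); congr nat_of_bool.
  by apply/idP/idP; rewrite !inE /D/=; [case|].
pose G := [set z : Omega * measurableTypeR R | z.2%:E < rf z.1].
have mG : measurable G.
  rewrite -[X in measurable X]setTI; apply: measurable_lte => //.
  exact: (measurableT_comp mrf measurable_fst).
have mhG : measurable_fun [set: Omega * measurableTypeR R]
    (fun z => h z * (\1_G z)%:E).
  apply: emeasurable_funM => //; apply/measurable_EFinP.
  exact: measurable_indic.
pose A z := \int[nu]_y a (z, y).
have mA : measurable_fun [set: Omega * measurableTypeR R] (fun z => h z * A z ^+ n).
  apply: emeasurable_funM => //; apply: emeasurable_funX.
  exact: measurable_fun_fubini_tonelli_F.
have hA0 z : 0 <= h z * A z ^+ n.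
  by rewrite mule_ge0// expe_ge0// integral_ge0.
have prodE (g : Omega * measurableTypeR R -> \bar R) :
    measurable_fun [set: Omega * measurableTypeR R] g -> (forall z, 0 <= g z) ->
    \int[probability_product P (@lebesgue_measure R)]_z g z =
    \int[P]_w \int[lebesgue_measure]_t g (w, t).
  by move=> mg g0; exact: (@fubini_tonelli1 _ _ _ _ _ P lebesgue_measure g mg g0).
apply: (@le_trans _ _ (\int[probability_product P (@lebesgue_measure R)]_z
    (h z * (\1_G z)%:E))).
  rewrite prodE//; last by move=> z; rewrite mule_ge0.
  rewrite le_eqVlt; apply/orP; left; apply/eqP; apply: eq_integral => w _.
  rewrite (hE w (fun t => (\1_G (w, t))%:E)).
  rewrite -[LHS](integral_indic_ltEFin (rho0 (xi w, f (xi w)))).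
  by apply: eq_integral => t _; rewrite !indicE.
apply: (@le_trans _ _ (\int[probability_product P (@lebesgue_measure R)]_z
    (h z * \big[mule/1]_(y <- s) a (z, y)))).
  apply: ge0_le_integral => //.
  - by move=> z _; rewrite mule_ge0.
  - apply: emeasurable_funM => //; apply: emeasurable_prod => y.
    exact: measurable_fun_pair1.
  - move=> z _; rewrite lee_wpmul2l// indicE.
    have [zG|zG] := boolP (z \in G); last by rewrite prode_ge0.
    rewrite big1_seq//= => y ys; rewrite /a indicE mem_set// /T/=.
    by move: zG; rewrite inE /G/= => /lt_le_trans; apply; exact: f_min.
apply: (le_trans le_s); rewrite prodE//.
have mI := @measurable_fun_fubini_tonelli_F _ _ _ _ _ (@lebesgue_measure R) _ mA hA0.
apply: (@le_trans _ _ (\int[P]_w cst V w)); last first.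
  by rewrite integral_cst// [X in _ * X](@probability_setT _ _ _ P) mule1.
apply: ge0_le_integral => //.
- by move=> w _; apply: integral_ge0.
- move=> w _; apply: le_trans (tail_le (xi w)).
  rewrite (hE w (fun t => A (w, t) ^+ n)) le_eqVlt; apply/orP; left; apply/eqP.
  apply: eq_integral => t _; congr (_ ^+ n).
  rewrite /A -[X in nu X]setIT -integral_indic//.
  have := measurable_xsection (w, t) mT; congr measurable.
  by apply/seteqP; split=> y; rewrite /xsection/= inE.
Qed.

(** * Tail bounds from superregularity *)

(** At delta = (2/b)^(1/m) superregularity would give a set of measure at least
2. *)
Lemma superregular_lty dX dY (X : measurableType dX) (Y : measurableType dY)
    (R : realType) (rho : X * Y -> \bar R) (nu : {measure set Y -> \bar R})
    (m b : R) (delta0 : \bar R) (x : X) :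
  nu [set: Y] = 1 -> measurable_fun [set: X * Y] rho -> (0 < m)%R ->
  superregular rho nu m b delta0 -> delta0 < +oo.
Proof.
move=> nu1 mrho m0 [_ b0 _ reg]; rewrite ltNge leye_eq; apply/negP => /eqP dE.
have b2 : (0 < 2 / b)%R by rewrite divr_gt0.
have := reg x ((2 / b) `^ m^-1)%R; rewrite powR_gt0// dE ltry => /(_ isT isT).
apply/negP; rewrite -ltNge -powRrM mulVf ?gt_eqF// powRr1 ?(ltW b2)//.
rewrite (mulrC b) divfK ?gt_eqF// (@le_lt_trans _ _ 1) ?lte_fin ?ltr1n// -nu1.
apply: le_measure; rewrite ?inE//.
rewrite -[X in measurable X]setTI; apply: measurable_lte => //.
exact: measurable_fun_pair2.
Qed.

(** The codewords missing by more than t lie outside every ball of radius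
r < s, whence the bound 1 - b * r ^ m.  The endpoint s itself, which may equal
the radius d where superregularity says nothing, is reached by letting r tend
to s. *)
Lemma superregular_tail dX dY (X : measurableType dX) (Y : measurableType dY)
    (R : realType) (rho : X * Y -> \bar R) (nu : {measure set Y -> \bar R})
    (k m b d : R) (x : X) (s t : R) :
  nu [set: Y] = 1 -> distortion rho -> (0 < k)%R -> (0 < m)%R ->
  superregular (fun z => rho z `^ k^-1) nu m b d%:E ->
  (0 < s)%R -> (s <= d)%R -> (s `^ k <= t)%R ->
  nu [set y | t%:E < rho (x, y)] <= (expR (- (b * s `^ m)))%:E.
Proof.
move=> nu1 [mrho rho0] k0 m0 [_ b0 _ reg] s0 sd st.
set T := [set y | _].
have mx : measurable_fun [set: Y] (fun y => rho (x, y)).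
  exact: measurable_fun_pair2.
have mT : measurable T.
  rewrite -[X in measurable X]setTI; exact: measurable_lte.
have le_r (r : R) : (0 < r)%R -> (r < s)%R -> nu T <= (1 - b * r `^ m)%:E.
  move=> r0 rs; set B := [set y | rho (x, y) `^ k^-1 < r%:E].
  have mB : measurable B.
    rewrite -[X in measurable X]setTI; apply: measurable_lte => //.
    exact: (measurableT_comp (measurable_poweR k^-1) mx).
  have regr : (b * r `^ m)%:E <= nu B.
    by apply: reg => //; rewrite lte_fin (lt_le_trans rs).
  (* on T the root of rho is at least s, hence at least r *)
  have TB : T `&` B = set0.
    apply/seteqP; split => // y [/= ty]; apply/negP; rewrite -leNgt.
    rewrite (@le_trans _ _ ((s `^ k)%:E `^ k^-1))//.
      rewrite poweR_EFin -powRrM mulfV ?gt_eqF// powRr1 ?(ltW s0)//.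
      by rewrite lee_fin ltW.
    apply: gt0_ler_poweR; rewrite ?in_itv/= ?leey ?andbT ?rho0//.
    - by rewrite invr_ge0 ltW.
    - by rewrite lee_fin powR_ge0.
    - by rewrite (le_trans _ (ltW ty))// lee_fin.
  rewrite EFinB leeBrDr// (le_trans (leeD2l _ regr))// -measureU//.
  by rewrite -nu1; apply: le_measure; rewrite ?inE//; exact: measurableU.
have Tfin : nu T \is a fin_num.
  rewrite ge0_fin_numE// (@le_lt_trans _ _ 1) ?ltry// -nu1.
  by rewrite le_measure ?inE.
have le_s : nu T <= (1 - b * s `^ m)%:E.
  rewrite -(fineK Tfin) lee_fin leNgt; apply/negP => lt_nu.
  pose v := ((1 - fine (nu T)) / b)%R.
  have vs : (v < s `^ m)%R by rewrite /v ltr_pdivrMr//; lra.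
  have v0 : (0 <= v)%R.
    rewrite divr_ge0 ?(ltW b0)// subr_ge0 -lee_fin fineK// -nu1.
    by rewrite le_measure ?inE.
  have vs' : (v `^ m^-1 < s)%R.
    rewrite -(powRr1 (ltW s0)) -(@mulfV _ m) ?gt_eqF// powRrM.
    by rewrite gt0_ltr_powR ?invr_gt0 ?nnegrE ?powR_ge0.
  have v1 : (0 <= v `^ m^-1)%R by exact: powR_ge0.
  (* any r strictly between v^(1/m) and s contradicts le_r *)
  pose r := ((v `^ m^-1 + s) / 2)%R.
  have [vr rs] : (v `^ m^-1 < r /\ r < s)%R by rewrite /r; lra.
  have r0 : (0 < r)%R by exact: le_lt_trans vr.
  have := le_r r r0 rs; rewrite -(fineK Tfin) lee_fin; apply/negP; rewrite -ltNge.
  have : (v < r `^ m)%R.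
    rewrite -(powRr1 v0) -(@mulVf _ m) ?gt_eqF// powRrM.
    by rewrite gt0_ltr_powR ?nnegrE ?powR_ge0// ltW.
  by rewrite /v ltr_pdivrMr//; lra.
by apply: (le_trans le_s); rewrite lee_fin; exact: expR_ge1Dx.
Qed.

(** Almost every y has all its distortions at most beta^k. *)
Lemma ess_sup_root_tail dX dY (X : measurableType dX) (Y : measurableType dY)
    (R : realType) (rho : X * Y -> \bar R) (nu : {measure set Y -> \bar R})
    (k : R) (x : X) (t : R) :
  distortion rho -> (0 < k)%R -> ess_sup_root rho nu k `^ k <= t%:E ->
  nu [set y | t%:E < rho (x, y)] = 0.
Proof.
move=> [mrho rho0] k0 le_t.
have mx : measurable_fun [set: Y] (fun y => rho (x, y)).
  exact: measurable_fun_pair2.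
apply/negligibleP.
  by rewrite -[X in measurable X]setTI; exact: measurable_lte.
have := ess_sup_ge nu (fun y => ereal_sup (range (fun x => rho (x, y) `^ k^-1))).
apply: negligibleS => y /= t_lt le_sup.
move: t_lt; apply/negP; rewrite -leNgt (le_trans _ le_t)//.
have rootx : rho (x, y) `^ k^-1 <= ess_sup_root rho nu k.
  by apply: le_trans le_sup; apply: ereal_sup_ubound; exists x.
rewrite -[leLHS](@poweRe1 _ _) // -(@mulVf _ k) ?gt_eqF// poweRrM.
apply: gt0_ler_poweR => //; rewrite ?in_itv/= ?leey ?andbT ?poweR_ge0//.
- exact: ltW.
- by apply: le_trans rootx; exact: poweR_ge0.
Qed.

Lemma measurable_tail dX dY (X : measurableType dX) (Y : measurableType dY)
    (R : realType) (rho : X * Y -> \bar R)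
    (nu : {sigma_finite_measure set Y -> \bar R}) (x : X) :
  measurable_fun [set: X * Y] rho ->
  measurable_fun [set: R] (fun t : R => nu [set y | t%:E < rho (x, y)]).
Proof.
move=> mrho; pose E := [set u : R * Y | u.1%:E < rho (x, u.2)].
have mE : measurable E.
  rewrite -[X in measurable X]setTI; apply: measurable_lte => //.
  - by apply/measurable_EFinP; exact: measurable_fst.
  - exact: (measurableT_comp (measurable_fun_pair2 x mrho) measurable_snd).
rewrite (_ : (fun t => _) = nu \o xsection E).
  exact: measurable_fun_xsection.
apply/funext => t /=; congr (nu _).
by apply/seteqP; split=> y; rewrite /xsection/= inE.
Qed.

(** The tail of rho (x, .) under [nu] is dominated by a stretched exponential
up to delta0^k, by a constant from there to beta^k, and is 0 beyond; when
beta <= delta0 the middle range is empty. *)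
Lemma integral_tail_le dX dY (X : measurableType dX) (Y : measurableType dY)
    (R : realType) (rho : X * Y -> \bar R)
    (nu : {sigma_finite_measure set Y -> \bar R})
    (k m b : R) (delta0 beta : \bar R) (x : X) (n : nat) :
  nu [set: Y] = 1 -> distortion rho -> (0 < k)%R -> (0 < m)%R ->
  superregular (fun z => rho z `^ k^-1) nu m b delta0 ->
  beta = ess_sup_root rho nu k -> (delta0 < +oo -> beta < +oo) -> (0 < n)%N ->
  \int[lebesgue_measure]_(t in `]0%R, +oo[) nu [set y | t%:E < rho (x, y)] ^+ n
  <= quantization_bound k m b delta0 beta n.
Proof.
move=> nu1 rho_dist k0 m0 reg betaE beta_fin n0.
have [mrho rho0] := rho_dist; have [_ b0 delta0_gt0 _] := reg.
have d_fin : delta0 < +oo.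
  apply: superregular_lty x nu1 _ m0 reg.
  exact: measurableT_comp (measurable_poweR _) mrho.
have {beta_fin} := beta_fin d_fin.
have beta0 : 0 <= beta.
  rewrite betaE.
  have nuT : 0 < nu [set: Y] by rewrite nu1 lte01.
  apply: (ess_sup_gee nuT).
  apply: nearW => y; apply: le_trans (ereal_sup_ubound _); last by exists x.
  exact: poweR_ge0.
case: beta betaE beta0 => [B| |//] // betaE; rewrite lee_fin => B0 _.
case: delta0 delta0_gt0 d_fin reg => [d| |]// d0 _ reg; rewrite lte_fin in d0.
set F := fun t : R => nu [set y | t%:E < rho (x, y)].
have F0 t : 0 <= F t by [].
have mFn (D : set R) : measurable_fun D (fun t => F t ^+ n).
  by apply: measurable_funTS; apply: emeasurable_funX; exact: measurable_tail.
have bn0 : (0 < b * n%:R)%R by rewrite mulr_gt0// ltr0n.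
have mk0 : (0 < m / k)%R by rewrite divr_gt0.
(* s = t^(1/k) is the useful choice below d^k, and s = d above it *)
have Fn_le s t : (0 < s)%R -> (s <= d)%R -> (s `^ k <= t)%R ->
    F t ^+ n <= (expR (- (b * n%:R * s `^ m)))%:E.
  move=> s0 sd st; have F_le := superregular_tail x nu1 rho_dist k0 m0 reg s0 sd st.
  apply: (le_trans (lee_expe n (F0 t) F_le)).
  rewrite -EFin_expe -expRM_natl lee_fin le_eqVlt; apply/orP; left; apply/eqP.
  by congr expR; ring.
have rootK t : (0 < t)%R -> ((t `^ k^-1) `^ k = t)%R.
  by move=> t0; rewrite -powRrM mulVf ?gt_eqF// powRr1 ?ltW.
have Fn_small t : (0 < t)%R -> (t <= d `^ k)%R ->
    F t ^+ n <= (expR (- (b * n%:R * t `^ (m / k))))%:E.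
  move=> t0 td; rewrite [(m / k)%R]mulrC powRrM.
  apply: Fn_le; rewrite ?powR_gt0// ?rootK//.
  rewrite -(powRr1 (ltW d0)) -(@mulfV _ k) ?gt_eqF// powRrM.
  by rewrite ge0_ler_powR ?invr_ge0 ?nnegrE ?powR_ge0 ?(ltW t0) ?(ltW k0).
have Fn_large t : (B `^ k <= t)%R -> F t ^+ n = 0.
  move=> Bt; apply/eqP; rewrite expe_eq0 n0/=; apply/eqP.
  have le_t : ess_sup_root rho nu k `^ k <= t%:E by rewrite -betaE poweR_EFin lee_fin.
  exact: (ess_sup_root_tail x rho_dist k0 le_t).
have mexp c p (D : set R) : measurable_fun D (fun t : R => (expR (- (c * t `^ p)))%:E).
  apply: measurable_funTS; apply/measurable_EFinP.
  apply: (measurableT_comp (@measurable_expR R)).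
  rewrite (_ : (fun t => _) = (fun t => - c * t `^ p)%R).
    by apply: measurable_funM => //; exact: measurable_powR.
  by apply/funext => t; rewrite mulNr.
have int_main : \int[lebesgue_measure]_(t in `]0%R, +oo[)
    (expR (- (b * n%:R * t `^ (m / k))))%:E =
    (Gamma (1 + k / m) * (b * n%:R) `^ (- (k / m)))%:E.
  by rewrite integral_stretched_exponential// invf_div.
rewrite /quantization_bound lee_fin -int_main; case: ifPn => Bd.
  apply: ge0_le_integral => //= [t _|||t].
  - exact: expe_ge0.
  - exact: mFn.
  - exact: mexp.
  rewrite in_itv/= andbT => t0.
  have [/(Fn_small t t0)//|dt] := leP t (d `^ k)%R.
  rewrite Fn_large ?lee_fin ?expR_ge0// (le_trans _ (ltW dt))//.
  by rewrite ge0_ler_powR ?nnegrE ?(ltW k0) ?(ltW d0).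
rewrite -ltNge in Bd.
have dB : (d `^ k < B `^ k)%R by rewrite gt0_ltr_powR// nnegrE ltW.
pose e := (expR (- (b * n%:R * d `^ m)))%:E.
pose I := [set` `](d `^ k)%R, (B `^ k)%R]] : set R.
have int_e : \int[lebesgue_measure]_(t in `]0%R, +oo[) ((cst e \_ I) t) =
    (B%:E `^ k - d%:E `^ k) * expeR (- ((b * n%:R)%:E * d%:E `^ m)).
  rewrite -integral_mkcondr setIidr; last first.
    move=> t; rewrite /I/= !in_itv/= andbT => /andP[dt _].
    by rewrite (le_lt_trans _ dt)// powR_ge0.
  rewrite integral_cst//= /I; last exact: measurable_itv.
  by rewrite lebesgue_measure_itv/= lte_fin dB muleC.
have e_ge0 t : 0 <= (cst e \_ I) t.
  by rewrite patchE; case: ifP => // _; rewrite lee_fin expR_ge0.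
have me (D : set (measurableTypeR R)) :
    measurable_fun D (cst e \_ I : measurableTypeR R -> \bar R).
  apply: measurable_funTS; apply: (iffLR (measurable_restrictT _ _)) => //.
  exact: measurable_itv.
rewrite -int_e -ge0_integralD//=; last exact: mexp.
apply: ge0_le_integral => //= [t _|||t].
- exact: expe_ge0.
- exact: mFn.
- by apply: emeasurable_funD; [exact: mexp|exact: me].
rewrite in_itv/= andbT => t0.
have [td|dt] := leP t (d `^ k)%R.
  by apply: le_trans (Fn_small t t0 td) _; rewrite leeDl//.
have [Bt|tB] := leP (B `^ k)%R t.
  by rewrite Fn_large// adde_ge0 ?lee_fin ?expR_ge0.
rewrite patchE mem_setE in_itv/= dt (ltW tB)/=.
rewrite (le_trans (Fn_le d t d0 (lexx d) (ltW dt)))//.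
by rewrite leeDr// lee_fin expR_ge0.
Qed.

(** * The upper bound on the quantization error *)

Theorem theorem4p2 (R : realType) (dX dY : measure_display)
    (X : measurableType dX) (Y : measurableType dY)
    (singleX : forall x : X, measurable [set x])
    (singleY : forall y : Y, measurable [set y])
    (nu : {finite_measure set Y -> \bar R}) (nu1 : nu [set: Y] = 1)
    (rho : X * Y -> \bar R) (rho_dist : distortion rho)
    (k : R) (k_gt0 : (0 < k)%R)
    (m b : R) (delta0 : \bar R) (m_gt0 : (0 < m)%R)
    (nu_superreg : superregular (fun z => rho z `^ k^-1) nu m b delta0)
    (beta : \bar R) (betaE : beta = ess_sup_root rho nu k)
    (beta_fin : delta0 < +oo -> beta < +oo) :
  forall (dO : measure_display) (Omega : measurableType dO)
         (P : probability Omega R) (xi : {RV P >-> X}) (n : nat),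
    (0 < n)%N ->
    quantization_error P rho n xi <= quantization_bound k m b delta0 beta n.
Proof.
move=> dO Omega P xi n n0.
apply: (quantization_error_le_tail xi nu1 rho_dist n0) => x.
exact: integral_tail_le.
Qed.
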